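(* Let $p\ge 1$ be an integer and let $\mathcal{K}$ be a $(p-1)$-neighborly simplicial complex on $[m]$. Then $\mathcal{K}$ is $p$-neighborly if and only if $$HH_{-1,2p+2}(\mathcal{Z}_{\mathcal{K}};\mathbb{Z})=0,$$ or equivalently $HH_p^{p+1}(\mathcal{Z}_{\mathcal{K}};\mathbb{Z})=0$.
   Context: Simplicial complexes: $[m]=\{1,\dots,m\}$. A simplicial complex $\mathcal{K}$ on $[m]$ is a nonempty family of subsets (faces) of $[m]$ closed under taking subsets; in particular $\emptyset\in\mathcal{K}$. It is assumed to have no ghost vertices, i.e. $\{x\}\in\mathcal{K}$ for every $x\in[m]$. For $J\subseteq [m]$, $\mathcal{K}_J=\{\sigma\in\mathcal{K}:\sigma\subseteq J\}$. For an integer $p\ge 0$, $\mathcal{K}$ is $p$-neighborly if for every $J\subseteq[m]$ with $|J|=p+1$ the full subcomplex $\mathcal{K}_J$ is the full simplex $\Delta^p$ (i.e. $J\in\mathcal{K}$). Double homology: for a commutative ring $R$ and a complex $\mathcal{K}$ on $[m]$, the homology of the moment-angle complex $\mathcal{Z}_{\mathcal{K}}=\bigcup_{\sigma\in\mathcal{K}}\big(\prod_{i\in\sigma}D^2\times\prod_{i\in[m]\setminus\sigma}S^1\big)\subseteq (D^2)^m$ has the bigraded (Hochster) decomposition $H_{-k,2l}(\mathcal{Z}_{\mathcal{K}};R)=\bigoplus_{J\subseteq[m],|J|=l}\tilde H_{l-k-1}(\mathcal{K}_J;R)$, with $\tilde H_*$ reduced simplicial homology (so $\tilde H_{-1}(\{\emptyset\};R)=R$).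 For $J\subseteq[m]$ and $x\in[m]\setminus J$ let $\Phi_{J,x;q}:\tilde H_q(\mathcal{K}_J;R)\to\tilde H_q(\mathcal{K}_{J\cup\{x\}};R)$ be induced by inclusion and let $\varepsilon(J,x)=(-1)^{|\{y\in J:\,y<x\}|}$. The differential $d_{-k,2l}=\sum_{|J|=l}\sum_{x\in[m]\setminus J}\varepsilon(J,x)\Phi_{J,x;l-k-1}$ maps $H_{-k,2l}(\mathcal{Z}_{\mathcal{K}};R)$ to $H_{-k-1,2l+2}(\mathcal{Z}_{\mathcal{K}};R)$. The cohomology of the resulting cochain complex $CH_*(\mathcal{Z}_{\mathcal{K}};R)$ is the double homology $HH_{-k,2l}(\mathcal{Z}_{\mathcal{K}};R)$. In the regrading $CH_j^l(\mathcal{Z}_{\mathcal{K}};R)=CH_{j-l,2l}(\mathcal{Z}_{\mathcal{K}};R)=\bigoplus_{|J|=l}\tilde H_{j-1}(\mathcal{K}_J;R)$ the differential maps $CH_j^l\to CH_j^{l+1}$, and $HH_j^l(\mathcal{Z}_{\mathcal{K}};R)=H^l(CH_j^*(\mathcal{Z}_{\mathcal{K}};R))=HH_{j-l,2l}(\mathcal{Z}_{\mathcal{K}};R)$. *)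

(* Defs.v *)
From HB Require Import structures.
From mathcomp Require Import all_boot all_order all_algebra.
From mathcomp Require Import ring_quotient.
From mathcomp Require Import boolp.

Set Implicit Arguments.
Unset Strict Implicit.
Unset Printing Implicit Defensive.

Import GRing.Theory.
Local Open Scope ring_scope.
Local Open Scope quotient_scope.

(* Homology of a group endomorphism [d] of [V] at a graded piece: for subgroups
   [P] (the piece itself) and [Q] (the piece that [d] maps into it), the group
   ker (d restricted to P) / d(Q).  When [d] maps [Q] into [P] and [d \o d] is
   zero, d(Q) lies in the kernel (see [bd_bd], [bd_chain], [ddiff_ddiff] and
   [ddiff_graded] below), so this is the usual quotient. *)
Section Homology.
Variables (V : zmodType) (d : {additive V -> V}).

Section Def.
Variables P Q : zmodClosed V.

Definition cycle_pred : {pred V} := [pred v | (v \in P) && (d v == 0)].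

Fact cycle_pred_closed : zmod_closed cycle_pred.
Proof.
split=> [|u v]; rewrite !inE ?rpred0 ?raddf0 ?eqxx //.
by move=> /andP[Pu /eqP du] /andP[Pv /eqP dv]; rewrite rpredB // raddfB du dv subrr /=.
Qed.
HB.instance Definition _ :=
  GRing.isZmodClosed.Build V cycle_pred cycle_pred_closed.

Record cycle := Cycle { cycle_val : V; _ : cycle_val \in cycle_pred }.
HB.instance Definition _ := [isSub for cycle_val].
HB.instance Definition _ := [Choice of cycle by <:].
HB.instance Definition _ := [SubChoice_isSubZmodule of cycle by <:].

Definition boundary : {pred cycle} :=
  fun z => `[< exists2 u, u \in Q & d u = val z >].

Fact boundary_closed : zmod_closed boundary.
Proof.
split=> [|y z]; first by apply/asboolP; exists 0; rewrite ?rpred0 ?raddf0.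
move=> /asboolP[u Qu du] /asboolP[v Qv dv]; apply/asboolP.
by exists (u - v); rewrite ?rpredB // !raddfB du dv.
Qed.
HB.instance Definition _ :=
  GRing.isZmodClosed.Build cycle boundary boundary_closed.

Definition homology : zmodType := Quotient.quot boundary.
Definition hclass (z : cycle) : homology := \pi_(Quotient.quot boundary) z.
Definition hrepr (h : homology) : cycle := repr (h : Quotient.quot boundary).

Lemma hreprK h : hclass (hrepr h) = h.
Proof. exact: reprK. Qed.

Lemma hclass_eq y z :
  hclass y = hclass z <-> exists2 u, u \in Q & d u = val y - val z.
Proof.
split=> [/eqP|[u Qu du]].
  by rewrite -Quotient.idealrBE => /asboolP[u Qu du]; exists u; rewrite // du raddfB.
by apply/eqP; rewrite -Quotient.idealrBE; apply/asboolP; exists u; rewrite // du raddfB.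
Qed.

Fact hclass_zmod_morphism : zmod_morphism hclass.
Proof. by move=> y z; rewrite /hclass raddfB. Qed.
HB.instance Definition _ :=
  GRing.isZmodMorphism.Build cycle homology hclass hclass_zmod_morphism.

End Def.

Section Incl.
Variables P Q P' Q' : zmodClosed V.
Hypothesis sPP' : {subset P <= P'}.

Fact cycle_incl_subproof (z : cycle P) : val z \in cycle_pred P'.
Proof. by case: z => z /=; rewrite !inE => /andP[/sPP'-> ->]. Qed.

Definition cycle_incl (z : cycle P) : cycle P' := Cycle (cycle_incl_subproof z).

(* The map induced by the inclusion of [P] in [P']; it does not depend on the
   representatives when [Q] is included in [Q'] ([hmap_class]). *)
Definition hmap (h : homology P Q) : homology P' Q' :=
  hclass Q' (cycle_incl (hrepr h)).

Hypothesis sQQ' : {subset Q <= Q'}.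

Lemma hmap_class z : hmap (hclass Q z) = hclass Q' (cycle_incl z).
Proof.
apply/hclass_eq; have /hclass_eq[u /sQQ' Qu du] := hreprK (hclass Q z).
by exists u.
Qed.

Lemma hmap_zmod_morphism : zmod_morphism hmap.
Proof.
move=> g h; rewrite -[g]hreprK -[h]hreprK -raddfB !hmap_class -raddfB.
by congr (hclass _ _); apply: val_inj.
Qed.

End Incl.
End Homology.

(* [(-1) ^ #|{y in s | y < x}|]: it is both the sign of the ordered simplicial
   boundary and the sign of the double homology differential. *)
Definition esgn (m : nat) (s : {set 'I_m}) (x : 'I_m) : int :=
  (-1) ^+ #|[set y in s | (y < x)%N]|.

Lemma esgnU1 (m : nat) (s : {set 'I_m}) (x y : 'I_m) :
  x \notin s -> esgn (x |: s) y = (-1) ^+ (x < y)%N * esgn s y.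
Proof.
move=> sx; rewrite /esgn -exprD; congr (_ ^+ _).
case: ltnP => [ltxy|leyx].
  have -> : [set z in x |: s | (z < y)%N] = x |: [set z in s | (z < y)%N].
    by apply/setP=> z; rewrite !inE; case: eqVneq => // ->; rewrite ltxy.
  by rewrite cardsU1 inE (negPf sx).
congr #|pred_of_set _|; apply/setP=> z; rewrite !inE.
by case: eqVneq => // ->; rewrite (negPf sx) ltnNge leyx.
Qed.

Lemma esgn_swap (m : nat) (s : {set 'I_m}) (x y : 'I_m) :
    x != y -> x \notin s -> y \notin s ->
  esgn s x * esgn (x |: s) y = - (esgn s y * esgn (y |: s) x).
Proof.
move=> neqxy sx sy; rewrite !esgnU1 //; move: neqxy; rewrite -val_eqE neq_ltn /=.
by case: ltngtP => // _ _; rewrite expr0 expr1 mul1r mulN1r mulrN ?opprK mulrC.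
Qed.

Lemma sum_antisym (m : nat) (V : zmodType) (P : pred 'I_m) (f : 'I_m -> 'I_m -> V) :
    (forall x y, P x -> P y -> x != y -> f x y = - f y x) ->
  \sum_(x | P x) \sum_(y | (y != x) && P y) f x y = 0.
Proof.
move=> fN; pose g (x y : 'I_m) := if (x < y)%N then f x y else 0.
have -> : \sum_(x | P x) \sum_(y | (y != x) && P y) f x y =
          \sum_(x | P x) \sum_(y | P y) (g x y - g y x).
  apply: eq_bigr => x Px; rewrite [RHS](bigID [pred y | y != x]) /= [X in _ + X]big1 ?addr0.
    apply: eq_big => [y|y /andP[neqyx Py]]; first exact: andbC.
    move: (neqyx); rewrite -val_eqE /g neq_ltn => /=.
    case: ltngtP => // _ _; rewrite ?subr0 // sub0r.
    by apply: fN => //; rewrite eq_sym.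
  by move=> y /andP[_ /negbNE/eqP->]; rewrite subrr.
under eq_bigr do rewrite sumrB.
by rewrite sumrB [X in _ - X]exchange_big subrr.
Qed.

(* The vertex set is 'I_m = {0, ..., m-1} instead of {1, ..., m}. *)
Record scomplex (m : nat) := SComplex {
  faces :> {set {set 'I_m}};
  faces_neq0 : faces != set0;
  faces_sub : forall s t : {set 'I_m}, s \in faces -> t \subset s -> t \in faces;
  faces_vertex : forall x : 'I_m, [set x] \in faces
}.

Definition restr (m : nat) (K : {set {set 'I_m}}) (J : {set 'I_m}) :
    {set {set 'I_m}} :=
  [set s in K | s \subset J].

Definition neighborly (m : nat) (K : scomplex m) (p : nat) : Prop :=
  forall J : {set 'I_m}, #|J| = p.+1 -> restr K J = powerset J.

(* All chain groups sit inside the functions {set 'I_m} -> R, a chain being its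
   family of coefficients; [chain F q] is the group of q-chains of the family of
   faces F, spanned by the faces with q + 1 vertices (q = -1 gives the empty
   face, so the complex is augmented). *)
Section ReducedHomology.
Variables (R : comPzRingType) (m : nat).
Implicit Types (F G : {set {set 'I_m}}) (s t : {set 'I_m}) (q : int).

Let A := {ffun {set 'I_m} -> R}.

(* The coefficient of [t] in the boundary of [c]. *)
Definition bd (c : A) : A :=
  [ffun t : {set 'I_m} => \sum_(x | x \notin t) (esgn t x)%:~R * c (x |: t)].

Fact bd_zmod_morphism : zmod_morphism bd.
Proof.
move=> b c; apply/ffunP=> t; rewrite !ffunE -sumrB; apply: eq_bigr => x _.
by rewrite !ffunE mulrBr.
Qed.
HB.instance Definition _ := GRing.isZmodMorphism.Build A A bd bd_zmod_morphism.

Definition chain F q : {pred A} :=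
  fun c => [forall s, (c s != 0) ==> (s \in F) && (#|s|%:Z == q + 1)].

Fact chain_closed F q : zmod_closed (chain F q).
Proof.
split=> [|b c]; first by apply/forallP=> s; rewrite ffunE eqxx.
move=> /forallP Fb /forallP Fc; apply/forallP=> s; apply/implyP; rewrite !ffunE.
apply: contraNT => Fs; move: (Fb s) (Fc s).
by rewrite (negPf Fs) !implybF !negbK => /eqP-> /eqP->; rewrite subrr.
Qed.
HB.instance Definition _ F q :=
  GRing.isZmodClosed.Build A (chain F q) (chain_closed F q).

Lemma chain_sub F G q : F \subset G -> {subset chain F q <= chain G q}.
Proof.
move=> /subsetP sFG c /forallP Fc; apply/forallP=> s; apply/implyP=> /(implyP (Fc s)).
by move=> /andP[/sFG-> ->].
Qed.

Lemma bd_bd c : bd (bd c) = 0.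
Proof.
apply/ffunP=> t; rewrite !ffunE.
transitivity (\sum_(x | x \notin t) \sum_(y | (y != x) && (y \notin t))
  (esgn t x * esgn (x |: t) y)%:~R * c (y |: (x |: t))).
  apply: eq_bigr => x tx; rewrite ffunE mulr_sumr.
  by apply: eq_big => [y|y _]; rewrite ?inE ?negb_or // intrM mulrA.
apply: sum_antisym => x y tx ty neqxy.
by rewrite esgn_swap // setUCA intrN mulNr.
Qed.

Lemma bd_chain (K : scomplex m) (J : {set 'I_m}) q c :
  c \in chain (restr K J) (q + 1) -> bd c \in chain (restr K J) q.
Proof.
move=> /forallP Kc; apply/forallP=> t; apply/implyP; apply: contraNT => Kt.
rewrite ffunE big1 // => x tx.
have [->|cxt] := eqVneq (c (x |: t)) 0; first by rewrite mulr0.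
case/negP: Kt; have /andP[] := implyP (Kc (x |: t)) cxt.
rewrite !inE => /andP[Kxt Jxt]; rewrite cardsU1 tx PoszD [X in X == _]addrC => /eqP E.
rewrite (faces_sub Kxt (subsetUr _ _)) (subset_trans (subsetUr _ _) Jxt) /=.
by apply/eqP; exact: addIr E.
Qed.

Definition rhomology F q : zmodType := homology bd (chain F q) (chain F (q + 1)).

Definition rhmap F G q (sFG : F \subset G) : rhomology F q -> rhomology G q :=
  fun h => hmap _ (chain_sub sFG) h.

End ReducedHomology.

Lemma restr_sub (m : nat) (K : {set {set 'I_m}}) (J L : {set 'I_m}) :
  J \subset L -> restr K J \subset restr K L.
Proof.
move=> sJL; apply/subsetP=> s; rewrite !inE => /andP[-> /= sJ].
exact: subset_trans sJ sJL.
Qed.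

Section DoubleHomology.
Variables (R : comPzRingType) (m : nat) (K : scomplex m).
Implicit Types (J L M : {set 'I_m}) (q l : int).

(* The direct sum, over all J, of the reduced homology groups of K_J in degree
   q. *)
Definition dsum q := {dffun forall J : {set 'I_m}, rhomology R (restr K J) q}.

Section Sum.
Variable q : int.

HB.instance Definition _ := Choice.on (dsum q).

Let zero : dsum q := [ffun J => 0].
Let opp (u : dsum q) : dsum q := [ffun J => - u J].
Let add (u v : dsum q) : dsum q := [ffun J => u J + v J].

Fact dsum_addA : associative add.
Proof. by move=> u v w; apply/ffunP=> J; rewrite !ffunE addrA. Qed.
Fact dsum_addC : commutative add.
Proof. by move=> u v; apply/ffunP=> J; rewrite !ffunE addrC. Qed.
Fact dsum_add0 : left_id zero add.
Proof. by move=> u; apply/ffunP=> J; rewrite !ffunE add0r. Qed.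
Fact dsum_addN : left_inverse zero opp add.
Proof. by move=> u; apply/ffunP=> J; rewrite !ffunE addNr. Qed.
HB.instance Definition _ := GRing.isZmodule.Build (dsum q)
  dsum_addA dsum_addC dsum_add0 dsum_addN.

Lemma dsum0E J : (0 : dsum q) J = 0. Proof. by rewrite ffunE. Qed.
Lemma dsumNE (u : dsum q) J : (- u) J = - u J. Proof. by rewrite ffunE. Qed.
Lemma dsumDE (u v : dsum q) J : (u + v) J = u J + v J.
Proof. by rewrite ffunE. Qed.

Definition Phi J L (sJL : J \subset L) :
    rhomology R (restr K J) q -> rhomology R (restr K L) q :=
  rhmap (restr_sub K sJL).

(* The L-component of the differential: the summands landing in L are indexed
   by the pairs (J, x) with x in L and J = L \ {x}. *)
Definition ddiff (u : dsum q) : dsum q :=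
  [ffun L : {set 'I_m} => \sum_(x in L)
     Phi (subD1set L x) (u (L :\ x)) *~ esgn (L :\ x) x].

Lemma Phi_zmod_morphism J L (sJL : J \subset L) : zmod_morphism (Phi sJL).
Proof. exact/hmap_zmod_morphism/chain_sub/restr_sub. Qed.
HB.instance Definition _ J L (sJL : J \subset L) :=
  GRing.isZmodMorphism.Build _ _ (Phi sJL) (Phi_zmod_morphism sJL).

Fact ddiff_zmod_morphism : zmod_morphism ddiff.
Proof.
move=> u v; apply/ffunP=> L; rewrite !(dsumDE, dsumNE, ffunE) -sumrB.
by apply: eq_bigr => x _; rewrite dsumDE dsumNE raddfB mulrzBl.
Qed.
HB.instance Definition _ :=
  GRing.isZmodMorphism.Build (dsum q) (dsum q) ddiff ddiff_zmod_morphism.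

(* CH^l, as a subgroup of the total sum. *)
Definition graded l : {pred dsum q} :=
  fun u => [forall J : {set 'I_m}, (u J != 0) ==> (#|J|%:Z == l)].

Fact graded_closed l : zmod_closed (graded l).
Proof.
split=> [|u v]; first by apply/forallP=> J; rewrite dsum0E eqxx.
move=> /forallP lu /forallP lv; apply/forallP=> J; apply/implyP.
rewrite dsumDE dsumNE; apply: contraNT => lJ; move: (lu J) (lv J).
by rewrite (negPf lJ) !implybF !negbK => /eqP-> /eqP->; rewrite subrr.
Qed.
HB.instance Definition _ l :=
  GRing.isZmodClosed.Build (dsum q) (graded l) (graded_closed l).

Lemma ddiff_graded l u : u \in graded l -> ddiff u \in graded (l + 1).
Proof.
move=> /forallP lu; apply/forallP=> L; apply/implyP; rewrite ffunE.
apply: contraNT => lL; rewrite big1 // => x Lx.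
have [->|uLx] := eqVneq (u (L :\ x)) 0; first by rewrite raddf0 mul0rz.
case/negP: lL; have /eqP <- := implyP (lu (L :\ x)) uLx.
by rewrite (cardsD1 x L) Lx PoszD addrC.
Qed.

Lemma Phi_class J L (sJL : J \subset L) z :
  Phi sJL (hclass _ z) = hclass _ (cycle_incl (chain_sub (restr_sub K sJL)) z).
Proof. exact/hmap_class/chain_sub/restr_sub. Qed.

Lemma PhiK J L M (sJL : J \subset L) (sLM : L \subset M) (sJM : J \subset M) h :
  Phi sLM (Phi sJL h) = Phi sJM h.
Proof.
rewrite -[h]hreprK; move: (hrepr h) => z.
rewrite (Phi_class sJL z) (Phi_class sJM z) Phi_class.
by apply: (congr1 (hclass _)); apply: val_inj.
Qed.

Lemma Phi_eq J J' L (sJL : J \subset L) (sJ'L : J' \subset L) (u : dsum q) :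
  J = J' -> Phi sJL (u J) = Phi sJ'L (u J').
Proof. by move=> eJ; case: J' / eJ sJ'L => sJ'L; rewrite (bool_irrelevance sJL sJ'L). Qed.

Lemma ddiff_ddiff u : ddiff (ddiff u) = 0.
Proof.
apply/ffunP=> L; rewrite dsum0E ffunE.
pose f x y := Phi (subset_trans (subD1set (L :\ x) y) (subD1set L x))
  (u (L :\ x :\ y)) *~ (esgn (L :\ x :\ y) y * esgn (L :\ x) x).
transitivity (\sum_(x in L) \sum_(y | (y != x) && (y \in L)) f x y).
  apply: eq_bigr => x Lx; rewrite ffunE raddf_sum mulrz_suml.
  apply: eq_big => [y|y _]; first by rewrite !inE.
  by rewrite raddfMz [X in X *~ _ *~ _](PhiK _ _ (subset_trans (subD1set _ y) (subD1set L x))) -mulrzA.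
apply: sum_antisym => x y Lx Ly neqxy.
have Exy : L :\ x :\ y = L :\ y :\ x by rewrite !setDDl setUC.
have -> : f x y = Phi (subset_trans (subD1set (L :\ y) x) (subD1set L y))
    (u (L :\ y :\ x)) *~ (esgn (L :\ x :\ y) y * esgn (L :\ x) x).
  by rewrite /f (Phi_eq _ (subset_trans (subD1set (L :\ y) x) (subD1set L y)) u Exy).
rewrite /f -mulrNz; apply: (congr1 (intmul _)).
have sx : x \notin L :\ y :\ x by rewrite !inE eqxx.
have sy : y \notin L :\ y :\ x by rewrite !inE eqxx andbF.
have := esgn_swap neqxy sx sy.
rewrite (setD1K (_ : x \in L :\ y)) ?inE ?neqxy // -Exy.
rewrite (setD1K (_ : y \in L :\ x)) ?inE 1?eq_sym ?neqxy // Exy => ->.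
by rewrite opprK.
Qed.

End Sum.

(* H^l of the complex with terms CH^l = the direct sum over the J with l
   vertices of the reduced homology groups of K_J in degree q. *)
Definition dhomology q l : zmodType :=
  homology (@ddiff q) (@graded q l) (@graded q (l - 1)).

(* HH_{-k,2l}: both indices are given without the sign and the factor 2. *)
Definition HHbi (k l : int) : zmodType := dhomology (l - k - 1) l.

(* HH_j^l. *)
Definition HH (j l : int) : zmodType := dhomology (j - 1) l.

End DoubleHomology.

(* Main.v *)
(* All J with at most p vertices are faces, so CH_p^p = 0 (a simplex is acyclic)
   and HH_p^(p+1) is the kernel of the differential on CH_p^(p+1).  If K is
   p-neighborly, then CH_p^(p+1) = 0 as well.  Otherwise, the family of the
   classes of the boundaries of the simplices J with p + 1 vertices is in the
   kernel, because its image at L is the class of the iterated boundary of the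
   simplex L, and it is nonzero at every missing face J. *)
Require Import Defs.
From mathcomp Require Import all_boot all_order all_algebra.
From mathcomp Require Import boolp.

Import GRing.Theory.
Local Open Scope ring_scope.

Section Preliminaries.
Set Implicit Arguments.
Unset Strict Implicit.

Lemma hclass_eq0 (V : zmodType) (d : {additive V -> V}) (P Q : zmodClosed V)
    (z : Defs.cycle d P) :
  hclass Q z = 0 <-> exists2 u, u \in Q & d u = val z.
Proof. by rewrite -(raddf0 (@hclass V d P Q)) hclass_eq [val 0]raddf0 subr0. Qed.

Lemma esgn_sqr (m : nat) (s : {set 'I_m}) (x : 'I_m) : esgn s x * esgn s x = 1.
Proof. by rewrite /esgn -exprD addnn -signr_odd odd_double. Qed.

End Preliminaries.

Section Chains.
Set Implicit Arguments.
Unset Strict Implicit.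
Variables (R : comPzRingType) (m : nat).
Implicit Types (F : {set {set 'I_m}}) (J s t : {set 'I_m}) (q : int).

Lemma chainP F q (c : {ffun {set 'I_m} -> R}) :
  reflect (forall s, c s != 0 -> s \in F /\ #|s|%:Z = q + 1) (c \in chain F q).
Proof.
apply: (iffP forallP) => Fc s.
  by move=> cs; have /andP[-> /eqP] := implyP (Fc s) cs.
by apply/implyP=> /Fc[-> /eqP].
Qed.

(** The join with the vertex [x]; faces of [c] that already contain [x] contribute nothing. *)
Definition cone (x : 'I_m) (c : {ffun {set 'I_m} -> R}) : {ffun {set 'I_m} -> R} :=
  [ffun s : {set 'I_m} => if x \in s then (esgn (s :\ x) x)%:~R * c (s :\ x) else 0].

(** This makes [cone x] a contracting homotopy. At a [t] without [x], only the term of [bd] that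
    adds [x] survives. At a [t] containing [x], the term of [bd c] that restores [x] gives [c t],
    and the terms that add another vertex cancel by [esgn_swap]. *)
Lemma bd_cone x c : bd (cone x c) + cone x (bd c) = c.
Proof.
apply/ffunP=> t; rewrite !ffunE; case: ifPn => tx; last first.
  rewrite addr0 (bigD1 x) //= ffunE setU11 setU1K // mulrA -intrM esgn_sqr mul1r.
  rewrite big1 ?addr0 // => y /andP[ty neqyx].
  by rewrite ffunE !inE eq_sym (negPf neqyx) (negPf tx) mulr0.
rewrite (bigD1 (P := [pred y | y \notin t :\ x]) x) ?inE ?eqxx //=.
rewrite setD1K // mulrDr mulrA -intrM esgn_sqr mul1r addrCA -[RHS]addr0.
congr (_ + _); rewrite mulr_sumr.
rewrite [X in _ + X](eq_bigl [pred y | y \notin t]) => [|y]; last first.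
  by rewrite !inE; case: eqVneq => [->|_]; rewrite ?tx ?andbT.
rewrite -big_split big1 //= => y ty.
have neqxy : x != y by apply: contraNneq ty => <-.
rewrite ffunE !inE tx orbT.
have -> : (y |: t) :\ x = y |: (t :\ x).
  by apply/setP=> z; rewrite !inE; case: (eqVneq z y) => [->|]; rewrite ?orbF //= eq_sym neqxy.
rewrite !mulrA -!intrM -mulrDl -intrD.
have sx : x \notin t :\ x by rewrite !inE eqxx.
have sy : y \notin t :\ x by rewrite !inE (negPf ty) andbF.
have := esgn_swap neqxy sx sy; rewrite setD1K // => E.
suff -> : esgn t y * esgn (y |: t :\ x) x + esgn (t :\ x) x * esgn (t :\ x) y = 0.
  by rewrite mul0r.
have -> : esgn t y = - (esgn (t :\ x) x * (esgn (t :\ x) y * esgn (y |: t :\ x) x)).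
  by rewrite -mulrN -E mulrA esgn_sqr mul1r.
by rewrite mulNr -!mulrA esgn_sqr mulr1 addNr.
Qed.

(** Coning from a vertex of [J] stays inside [powerset J], so by [bd_cone] every cycle bounds its
    own cone. *)
Lemma rhomology_simplex J q (h : rhomology R (powerset J) q) : J != set0 -> h = 0.
Proof.
case/set0Pn=> x Jx; rewrite -[h]hreprK; move: (hrepr h) => z.
apply/hclass_eq0; exists (cone x (val z)); last first.
  have := valP z; rewrite inE => /andP[_ /eqP dz].
  rewrite -[RHS](bd_cone x) dz.
  suff -> : cone x 0 = 0 by rewrite addr0.
  by apply/ffunP=> s; rewrite !ffunE mulr0 if_same.
have := valP z; rewrite inE => /andP[/chainP Jz _]; apply/chainP=> s.
rewrite ffunE; case: ifPn => [sx|]; last by rewrite eqxx.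
have [->|/Jz[]] := eqVneq (val z (s :\ x)) 0; first by rewrite mulr0 eqxx.
rewrite !inE => sJ szs _; split; last by rewrite (cardsD1 x) sx PoszD addrC szs.
by rewrite -(setD1K sx) subUset sub1set Jx.
Qed.

(** This lives in the ambient space of all functions, so [J] may be a missing face. *)
Definition simplex J : {ffun {set 'I_m} -> R} := [ffun s => (s == J)%:R].

Lemma bd_simplex J :
  bd (simplex J) = \sum_(x in J) simplex (J :\ x) *~ esgn (J :\ x) x.
Proof.
apply/ffunP=> t; rewrite ffunE sum_ffunE.
rewrite big_mkcond [RHS]big_mkcond; apply: eq_bigr => x _.
rewrite ffunMzE !ffunE; case: ifPn => [tx|]; last rewrite negbK => tx.
  case: ifPn => Jx.
    rewrite -[in RHS]mulrzl.
    have -> : (x |: t == J) = (t == J :\ x).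
      by apply/eqP/eqP=> [<-|->]; rewrite ?setU1K ?setD1K.
    by case: eqVneq => [->|_] //; rewrite !mulr0.
  case: eqP => [E|_]; last by rewrite mulr0.
  by rewrite -E setU11 in Jx.
case: ifP => // _; case: eqP => [E|_]; last by rewrite mul0rz.
by rewrite E !inE eqxx in tx.
Qed.

Lemma bd_simplex_chain F J q : #|J|%:Z = q + 2 ->
  {in J, forall x, J :\ x \in F} -> bd (simplex J) \in chain F q.
Proof.
move=> cJ FJ; apply/chainP=> t; apply: contra_neqP => Ft.
rewrite ffunE big1 // => x tx; rewrite ffunE; case: eqP => [E|]; last by rewrite mulr0.
case: Ft; have Et : t = J :\ x by rewrite -E setU1K.
split; first by rewrite Et FJ // -E setU11.
move: cJ; rewrite -E cardsU1 tx PoszD [X in X = _]addrC => cJ.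
by apply: (addIr 1); rewrite cJ -addrA.
Qed.

End Chains.

Section DoubleHomology.
Set Implicit Arguments.
Unset Strict Implicit.
Variables (m : nat) (K : scomplex m).
Implicit Types (J L : {set 'I_m}) (q l : int) (p : nat).

Lemma neighborly_setD1 p J x : neighborly K p -> #|J| = p.+2 -> x \in J ->
  J :\ x \in restr K J.
Proof.
move=> hK cJ Jx; have cJx : #|J :\ x| = p.+1.
  by apply: succn_inj; rewrite -cJ (cardsD1 x J) Jx.
have : J :\ x \in restr K (J :\ x) by rewrite hK ?powersetE.
by rewrite !inE subD1set => /andP[->].
Qed.

Section Acyclic.
Variable R : comPzRingType.

(** Every [J] with [p.+1] vertices spans a full nonempty simplex, which is acyclic in every degree
    [q]. *)
Lemma graded_neighborly_eq0 p q l (u : dsum R K q) :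
  neighborly K p -> l = p.+1%:Z -> u \in @graded R m K q l -> u = 0.
Proof.
move=> hK -> /forallP gu; apply/ffunP=> J; rewrite dsum0E.
have [//|/(implyP (gu J))/eqP[cJ]] := eqVneq (u J) 0.
move: (u J); rewrite (hK _ cJ) => h; apply: rhomology_simplex.
by rewrite -card_gt0 cJ.
Qed.

Lemma neighborly_dhomology_eq0 p q l (h : dhomology R K q l) :
  neighborly K p -> l = p.+1%:Z -> h = 0.
Proof.
move=> hK El; rewrite -[h]hreprK; move: (hrepr h) => z; apply/hclass_eq0.
exists 0; rewrite ?rpred0 // raddf0.
have := valP z; rewrite inE => /andP[gz _].
by rewrite (graded_neighborly_eq0 hK El gz).
Qed.

(* Where [bd (simplex R J)] is not a cycle of K_J, [insubd] makes the class 0. *)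
Definition simplex_classes q l : dsum R K q :=
  [ffun J : {set 'I_m} => if #|J|%:Z == l
     then hclass (chain (restr K J) (q + 1))
            (insubd (0 : Defs.cycle (@bd R m) (chain (restr K J) q)) (bd (simplex R J)))
     else 0].

Lemma simplex_classes_graded q l : simplex_classes q l \in @graded R m K q l.
Proof.
by apply/forallP=> J; apply/implyP; rewrite ffunE; case: ifP; rewrite ?eqxx.
Qed.

Lemma bd_simplex_cycle p J : neighborly K p -> #|J| = p.+2 ->
  bd (simplex R J) \in cycle_pred (@bd R m) (chain (restr K J) p).
Proof.
move=> hK cJ; rewrite inE; apply/andP; split; last exact/eqP/bd_bd.
apply: bd_simplex_chain; first by rewrite cJ -addn2 PoszD.
by move=> x Jx; exact: neighborly_setD1 hK cJ Jx.
Qed.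

(** [ddiff] and [bd] carry the same signs [esgn], so [bd_simplex] turns the sum over the vertices of
    [L] into [bd (bd (simplex R L))]. *)
Lemma ddiff_simplex_classes p :
  neighborly K p -> ddiff (simplex_classes p p.+2) = 0.
Proof.
move=> hK; apply/ffunP=> L; rewrite dsum0E.
(* By the grading, only an [L] with [p.+3] vertices can have a nonzero component. *)
have /forallP/(_ L) := ddiff_graded (simplex_classes_graded p p.+2).
have [//|_ /eqP cL] := eqVneq; rewrite ffunE.
have {}cL : #|L| = p.+3 by move: cL; rewrite -PoszD addn1 => -[].
pose z x := cycle_incl (chain_sub (restr_sub K (subD1set L x)))
  (insubd (0 : Defs.cycle (@bd R m) (chain (restr K (L :\ x)) p))
     (bd (simplex R (L :\ x)))).
have cLx x : x \in L -> #|L :\ x| = p.+2.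
  by move=> Lx; apply: succn_inj; rewrite -cL (cardsD1 x L) Lx.
transitivity (hclass (chain (restr K L) (p%:Z + 1))
    (\sum_(x in L) z x *~ esgn (L :\ x) x)).
  rewrite raddf_sum; apply: eq_bigr => x Lx.
  by rewrite raddfMz ffunE cLx // eqxx Phi_class.
(* The representative already vanishes as a chain, so it bounds 0. *)
apply/hclass_eq0; exists 0; rewrite ?rpred0 // raddf0 raddf_sum.
rewrite -[LHS](bd_bd (simplex R L)) bd_simplex raddf_sum.
apply: eq_bigr => x Lx; rewrite !raddfMz /= val_insubd.
by rewrite bd_simplex_cycle ?cLx.
Qed.

End Acyclic.

Lemma simplex_classes_neq0 (R : comNzRingType) p J : neighborly K p ->
  #|J| = p.+2 -> J \notin K -> simplex_classes R p p.+2 J <> 0.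
Proof.
move=> hK cJ KJ; rewrite ffunE cJ eqxx => /hclass_eq0[b /chainP Jb].
rewrite val_insubd bd_simplex_cycle //.
(* A face in the support of [b] lies in [J] and has [p.+2] vertices, so it would be the missing face
   [J]. *)
have -> : b = 0.
  apply/ffunP=> s; rewrite ffunE; apply: contraNeq KJ => /Jb[].
  rewrite inE => /andP[Ks sJ]; rewrite -!PoszD !addn1 => -[cs].
  suff <- : s = J by [].
  by apply/eqP; rewrite eqEcard sJ cJ cs leqnn.
rewrite raddf0 => /ffunP.
(* The coefficient of [bd (simplex R J)] at the facet [J :\ x] is a sign, nonzero because [R] is
   nontrivial. *)
have /set0Pn[x Jx] : J != set0 by rewrite -card_gt0 cJ.
move=> /(_ (J :\ x))/esym/eqP; rewrite !ffunE (bigD1 x) ?inE ?eqxx //=.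
rewrite ffunE setD1K // eqxx mulr1 big1 ?addr0 => [|y /andP[Jy neqyx]].
  by rewrite /esgn rmorphXn /= rmorphN1 signr_eq0.
rewrite ffunE; case: eqP => [/setP/(_ x)|]; last by rewrite mulr0.
by rewrite !inE eqxx eq_sym (negPf neqyx) Jx.
Qed.

Lemma dhomology_eq0_neighborly (R : comNzRingType) p : neighborly K p ->
  (forall h : dhomology R K p p.+2, h = 0) -> neighborly K p.+1.
Proof.
move=> hK h0 J cJ; have KJ : J \in K.
  apply/negPn/negP=> KJ; apply: (simplex_classes_neq0 (R := R) hK cJ KJ).
  have uP : simplex_classes R p p.+2 \in
      cycle_pred (@ddiff R m K p) (@graded R m K p p.+2).
    rewrite inE simplex_classes_graded; exact/eqP/ddiff_simplex_classes.
  (* A preimage [v] lives on sets with [p.+1] vertices, where [graded_neighborly_eq0] forces it to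
     be 0. *)
  have /hclass_eq0[v gv /= <-] :=
    h0 (hclass (@graded R m K p (p.+2%:Z - 1)) (Cycle uP)).
  by rewrite (graded_neighborly_eq0 hK _ gv) ?raddf0 ?dsum0E // -addn1 PoszD addrK.
apply/setP=> s; rewrite !inE andb_idl //; exact: faces_sub.
Qed.

End DoubleHomology.

Theorem theorem5p6 (m p : nat) (hp : (1 <= p)%N) (K : scomplex m)
    (hK : neighborly K (p - 1)%N) :
  (neighborly K p <-> (forall h : HHbi int K 1 (p%:Z + 1), h = 0)) /\
  (neighborly K p <-> (forall h : HH int K p%:Z (p%:Z + 1), h = 0)).
Proof.
case: p hp hK => // p _; rewrite subn1 /= => hK.
(* With [p] now standing for the old [p - 1], both gradings give the same group: the homological
   degree is [(p + 2) - 1 - 1 = p] for [HHbi] and [(p + 1) - 1 = p] for [HH]. *)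
suff HHP q l : q = p%:Z -> l = p.+2%:Z ->
    neighborly K p.+1 <-> forall h : dhomology int K q l, h = 0.
  have Ep : p.+1%:Z - 1 = p%:Z by rewrite -addn1 PoszD addrK.
  have El : p.+1%:Z + 1 = p.+2%:Z by rewrite -PoszD addn1.
  by split; apply: HHP; rewrite ?addrK.
move=> -> ->; split=> [hK1 h|]; last exact: dhomology_eq0_neighborly.
exact: neighborly_dhomology_eq0 hK1 _.
Qed.
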